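(* Let $F$ be a self-similar set in $\mathbb{R}^d$ satisfying the open set condition (OSC) and $\dim_M F<d$. Then the set $F$ possesses a compatible self-similar tiling $\mathcal{T}$ (of some suitable feasible open set $O$) if and only if $F^c=\mathbb{R}^d\setminus F$ is disconnected.
   Context: **Self-similar sets.** Let $N\ge 2$ and let $\varphi_1,\dots,\varphi_N:\mathbb{R}^d\to\mathbb{R}^d$ be contracting similarities with ratios in $(0,1)$. The self-similar set generated by $\{\varphi_1,\dots,\varphi_N\}$ is the unique nonempty compact set $F$ with $F=\bigcup_i\varphi_i(F)$. It satisfies OSC if there is a nonempty open set $O$, called a feasible open set of the system, with $\bigcup_i\varphi_i(O)\subset O$ and $\varphi_i(O)\cap\varphi_j(O)=\emptyset$ for $i\neq j$. $\dim_M$ denotes Minkowski (box) dimension (it exists for such $F$). **Self-similar tilings.** Let $\{\varphi_1,\dots,\varphi_N\}$ generate $F$, satisfying OSC, and let $O$ be a feasible open set. Put $\Phi(A)=\bigcup_{j=1}^N\varphi_j(A)$ and let $G:=O\setminus\Phi(\overline{O})$ (the generator). For a word $\sigma=\sigma_1\cdots\sigma_n$ over $\{1,\dots,N\}$ put $\varphi_\sigma=\varphi_{\sigma_1}\circ\dots\circ\varphi_{\sigma_n}$ (identity for the empty word). When $G\neq\emptyset$, the family $\mathcal T(O)=\{\varphi_\sigma(G):\sigma \text{ a finite word}\}$ is called the self-similar tiling of $O$. It is called compatible if $\partial O\subset F$. $F$ possesses a compatible self-similar tiling if there is a feasible open set $O$ such that $\mathcal T(O)$ is a compatible self-similar tiling.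 *)

(* Defs.v *)
From HB Require Import structures.
From mathcomp Require Import all_boot all_order all_algebra.
From mathcomp Require Import all_classical all_reals all_analysis.

Set Implicit Arguments.
Unset Strict Implicit.
Unset Printing Implicit Defensive.

Import Order.TTheory GRing.Theory Num.Theory.
Import numFieldNormedType.Exports.

Local Open Scope classical_set_scope.
Local Open Scope ring_scope.

Section Defs.
Context {R : realType} {d : nat}.
Local Notation V := 'rV[R]_d.
Implicit Types (A F O : set V).

(* The library norm on 'rV[R]_d is the sup norm. It induces the usual topology
   of R^d, but similarities have to preserve Euclidean distance ratios. *)
Definition edist (x y : V) : R := Num.sqrt (\sum_i (x 0 i - y 0 i) ^+ 2).

Definition boundary A : set V := closure A `\` interior A.

Definition covered_by_balls A (delta : R) (n : nat) : Prop :=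
  exists c : 'I_n -> V,
    A `<=` \bigcup_(i in [set: 'I_n]) [set x | edist (c i) x <= delta].

(* Least number of closed delta-balls covering A; meaningful for bounded A. *)
Definition covering_number A (delta : R) : R :=
  inf [set n%:R | n in [set n | covered_by_balls A delta n]].

(* As for every use of [lim], meaningful when the limit exists. *)
Definition minkowski_dim A : R :=
  lim ((ln (covering_number A delta) / - ln delta) @[delta --> 0^'+]).

Definition contracting_similarity (f : V -> V) : Prop :=
  exists2 r : R, 0 < r < 1 & forall x y, edist (f x) (f y) = r * edist x y.

Section System.
Context {N : nat}.
Implicit Types (phi : 'I_N -> V -> V) (T : set (set V)).

Definition Phi phi A : set V := \bigcup_(i in [set: 'I_N]) (phi i @` A).

(* Uniqueness of such an F is Hutchinson's theorem, not part of the definition. *)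
Definition self_similar_set phi F : Prop :=
  [/\ F !=set0, compact F & F = Phi phi F].

(* Boundedness of O is not required. *)
Definition feasible_open_set phi O : Prop :=
  [/\ O !=set0, open O, Phi phi O `<=` O
    & forall i j : 'I_N, i != j -> (phi i @` O) `&` (phi j @` O) = set0].

Definition open_set_condition phi : Prop := exists O, feasible_open_set phi O.

Definition generator phi O : set V := O `\` Phi phi (closure O).

(* word_map phi [:: s1; ...; sn] = phi s1 \o ... \o phi sn *)
Definition word_map phi (s : seq 'I_N) : V -> V :=
  foldr (fun i g => phi i \o g) id s.

Definition tiling_family phi O : set (set V) :=
  [set word_map phi s @` generator phi O | s in [set: seq 'I_N]].

Definition self_similar_tiling phi O T : Prop :=
  [/\ feasible_open_set phi O, generator phi O !=set0 & T = tiling_family phi O].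

Definition compatible_tiling phi F O T : Prop :=
  self_similar_tiling phi O T /\ boundary O `<=` F.

Definition possesses_compatible_tiling phi F : Prop :=
  exists O T, compatible_tiling phi F O T.

End System.
End Defs.

(* Main.v *)
Require Import Defs.
From HB Require Import structures.
From mathcomp Require Import all_boot all_order all_algebra.
From mathcomp Require Import all_classical all_reals all_analysis.
From mathcomp Require Import ring lra zify.

Set Implicit Arguments.
Unset Strict Implicit.
Unset Printing Implicit Defensive.

Import Order.TTheory GRing.Theory Num.Theory.
Import numFieldNormedType.Exports.

Local Open Scope classical_set_scope.
Local Open Scope ring_scope.

(* If [O] carries a compatible tiling, then [F^c] is the disjoint union of the
   open sets [O \ F] and [F^c \ closure O]; the generator makes the first
   nonempty, and the second is nonempty because a dense feasible open set would
   have intersecting images.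

   Conversely, [F] has empty interior since [dim_M F < d], and if [F^c] is
   disconnected there is a bounded nonempty open [U] with boundary in [F].
   Schief's argument gives a word [k] such that the sets [phi_{wk} U] with
   different first letters of [w] are disjoint. Then the union [O] of all
   [phi_{wk} U] is feasible and its boundary lies in [F]; its generator is
   nonempty, as otherwise [O] would be contained in its iterates and hence in
   [F]. *)

(* mathcomp-analysis has its own [edist]. *)
Local Notation edist := Defs.edist.

(** * Sup norm and Euclidean distance *)

Section Metric.
Context {R : realType} {d : nat}.
Local Notation V := 'rV[R]_d.
Implicit Types x y z : V.

Lemma rV_coord_le x j : `|x 0 j| <= `|x|.
Proof.
have := le_bigmax_cond (0 : R) (fun ij : 'I_1 * 'I_d => `|x ij.1 ij.2|)
  (erefl : xpredT (0, j)).
by rewrite -mx_normrE.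
Qed.

Lemma rV_norm_le x (e : R) : 0 <= e -> (forall j, `|x 0 j| <= e) -> `|x| <= e.
Proof.
move=> e0 h; have -> : `|x| = mx_norm x by [].
by rewrite mx_normrE; apply: bigmax_le => // -[i j] _ /=; rewrite (ord1 i).
Qed.

Lemma rV_norm_lt x (e : R) : 0 < e -> (forall j, `|x 0 j| < e) -> `|x| < e.
Proof.
move=> e0 h; have -> : `|x| = mx_norm x by [].
by rewrite mx_normrE; apply: bigmax_lt => // -[i j] _ /=; rewrite (ord1 i).
Qed.

Lemma edist_sqr x y : edist x y ^+ 2 = \sum_i (x 0 i - y 0 i) ^+ 2.
Proof. by rewrite sqr_sqrtr// sumr_ge0// => i _; exact: sqr_ge0. Qed.

Lemma edist_ge0 x y : 0 <= edist x y.
Proof. exact: sqrtr_ge0. Qed.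

Lemma norm_le_edist x y : `|x - y| <= edist x y.
Proof.
apply: rV_norm_le; first exact: edist_ge0.
move=> j; rewrite -sqrtr_sqr ler_wsqrtr// !mxE (bigD1 j)//= lerDl.
by rewrite sumr_ge0// => i _; exact: sqr_ge0.
Qed.

(** The sharp constant is the square root of [d]; [d.+1] avoids the root and is positive also for
    [d = 0], so that it can be divided by. *)
Lemma edist_le_norm x y : edist x y <= d.+1%:R * `|x - y|.
Proof.
rewrite -[leRHS]ger0_norm ?mulr_ge0// -sqrtr_sqr ler_wsqrtr//.
apply: (@le_trans _ _ (d%:R * `|x - y| ^+ 2)).
  rewrite mulr_natl -[X in _ *+ X]card_ord -sumr_const.
  apply: ler_sum => i _; rewrite -[leLHS]ger0_norm ?sqr_ge0// normrX.
  by rewrite lerXn2r ?nnegrE//; have := rV_coord_le (x - y) i; rewrite !mxE.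
rewrite exprMn ler_wpM2r ?sqr_ge0// -natrX ler_nat.
by rewrite expnS expn1 mulnS; lia.
Qed.

Lemma rV_nbhsP x (A : set V) :
  nbhs x A <-> exists2 e : R, 0 < e & forall y, `|x - y| < e -> A y.
Proof.
split=> [/nbhs_normP[e /= e0 eA]|[e e0 eA]]; first by exists e.
by apply: (proj2 (nbhs_normP (V := V) x A)); exists e.
Qed.

Lemma rV_openP (A : set V) :
  open A <-> forall x, A x -> exists2 e : R, 0 < e & forall y, `|x - y| < e -> A y.
Proof. by rewrite openE; split=> h x /h => [/rV_nbhsP|hx]//; apply/rV_nbhsP. Qed.

Lemma rV_closureP (A : set V) x :
  closure A x <-> forall e : R, 0 < e -> exists2 y, A y & `|x - y| < e.
Proof.
split=> [clA e e0|h B /rV_nbhsP[e /h[y Ay xy] eB]].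
  have [|y [Ay xy]] := clA [set y | `|x - y| < e]; last by exists y.
  by apply/rV_nbhsP; exists e.
by exists y; split => //; exact: eB.
Qed.

End Metric.

(** * Similarities *)

Section Similarity.
Context {R : realType} {d : nat}.
Local Notation V := 'rV[R]_d.
Local Notation D := (d.+1%:R : R).
Implicit Types x y z : V.

(** The ratio is explicit and need not be below 1, so the identity, which is the map of the empty
    word, is included. *)
Definition similarity (r : R) (f : V -> V) : Prop :=
  0 < r /\ forall x y, edist (f x) (f y) = r * edist x y.

Let dot x y : R := \sum_i x 0 i * y 0 i.

(** By polarization [g = f - f 0] multiplies dot products by [r ^+ 2]. The images of the unit
    vectors are thus the rows of a multiple of an orthogonal matrix, and [g] is recovered from its
    products with these rows. *)
Lemma similarity_affine r f : similarity r f ->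
  exists2 A : 'M[R]_d, A *m A^T = (r ^+ 2)%:M & forall x, f x = f 0 + x *m A.
Proof.
move=> [r0 fr]; pose g x := f x - f 0.
have dotB x y : dot x y = (edist x 0 ^+ 2 + edist y 0 ^+ 2 - edist x y ^+ 2) / 2.
  rewrite !edist_sqr /dot -big_split/= -sumrB mulr_suml.
  by apply: eq_bigr => i _; rewrite !mxE; field.
have dg x y : dot (g x) (g y) = r ^+ 2 * dot x y.
  have e x' y' : edist (g x') (g y') = r * edist x' y'.
    rewrite -fr /edist; congr Num.sqrt; apply: eq_bigr => i _.
    by rewrite !mxE; congr (_ ^+ 2); ring.
  rewrite !dotB; have g0 : g 0 = 0 by rewrite /g subrr.
  by rewrite -[in LHS]g0 !e !exprMn; field.
pose A : 'M[R]_d := \matrix_(i, j) g (delta_mx 0 i) 0 j.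
have AE x y : (x *m y^T) 0 0 = dot x y.
  by rewrite mxE; apply: eq_bigr => i _; rewrite !mxE.
(* No linearity of [g] is available yet: this identity, together with the invertibility of [A^T], is
   what yields it. *)
have gA x : g x *m A^T = r ^+ 2 *: x.
  apply/rowP => j; rewrite !mxE.
  have -> : \sum_j0 g x 0 j0 * A^T j0 j = dot (g x) (g (delta_mx 0 j)).
    by apply: eq_bigr => i _; rewrite !mxE.
  rewrite dg; congr (_ * _); rewrite /dot (bigD1 j)//= big1 ?addr0; last first.
    by move=> i ij; rewrite mxE (negbTE ij) andbF mulr0.
  by rewrite mxE !eqxx mulr1.
have AA : A *m A^T = (r ^+ 2)%:M.
  apply/row_matrixP => i; rewrite row_mul.
  have -> : row i A = g (delta_mx 0 i) by apply/rowP => j; rewrite !mxE.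
  by rewrite gA -scalemx1 linearZ /= row1.
have r20 : r ^+ 2 != 0 by rewrite expf_neq0// gt_eqF.
have AA' : A^T *m (r ^- 2 *: A) = 1%:M.
  by apply: mulmx1C; rewrite -scalemxAl AA scale_scalar_mx mulVf.
exists A => // x; rewrite addrC; apply/eqP; rewrite -subr_eq; apply/eqP.
rewrite -/(g x) -[g x]mulmx1 -AA' mulmxA gA -scalemxAl -scalemxAr scalerA.
by rewrite mulfV// scale1r.
Qed.

Section One.
Variables (r : R) (f : V -> V).
Hypothesis fr : similarity r f.

Lemma similarity_surj y : exists x, f x = y.
Proof.
have [A AA fA] := similarity_affine fr.
have r20 : r ^+ 2 != 0 by rewrite expf_neq0// gt_eqF// (proj1 fr).
have AA' : (r ^- 2 *: A^T) *m A = 1%:M.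
  by apply: mulmx1C; rewrite -scalemxAr AA scale_scalar_mx mulVf.
by exists ((y - f 0) *m (r ^- 2 *: A^T)); rewrite fA -mulmxA AA' mulmx1 addrC subrK.
Qed.

Lemma similarity_upper x y : `|f x - f y| <= D * r * `|x - y|.
Proof.
rewrite (le_trans (norm_le_edist _ _))// (proj2 fr) [D * r]mulrC -mulrA ler_wpM2l//.
  by rewrite ltW// (proj1 fr).
exact: edist_le_norm.
Qed.

Lemma similarity_lower x y : r * `|x - y| <= D * `|f x - f y|.
Proof.
rewrite (le_trans _ (edist_le_norm _ _))// (proj2 fr) ler_wpM2l//.
  by rewrite ltW// (proj1 fr).
exact: norm_le_edist.
Qed.

Lemma similarity_inj : injective f.
Proof.
move=> x y fxy; apply/eqP; rewrite -subr_eq0 -normr_eq0 eq_le normr_ge0 andbT.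
by have := similarity_lower x y; rewrite fxy subrr normr0 mulr0 pmulr_rle0// (proj1 fr).
Qed.

Lemma similarity_open_preimage A : open A -> open (f @^-1` A).
Proof.
have Dr0 : 0 < D * r by rewrite mulr_gt0// (proj1 fr).
move=> /rV_openP oA; apply/rV_openP => x /oA[e e0 eA].
exists (e / (D * r)) => [|y xy]; first exact: divr_gt0.
by apply: eA; rewrite (le_lt_trans (similarity_upper _ _))// mulrC -ltr_pdivlMr.
Qed.

Lemma similarity_open A : open A -> open (f @` A).
Proof.
move=> /rV_openP oA; apply/rV_openP => _ [x /oA[e e0 eA] <-].
exists (r * e / D) => [|y xy]; first by rewrite divr_gt0// mulr_gt0// (proj1 fr).
have [z zy] := similarity_surj y; exists z => //; apply: eA.
rewrite -(ltr_pM2l (proj1 fr)) (le_lt_trans (similarity_lower _ _))//.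
by rewrite mulrC -ltr_pdivlMr// zy.
Qed.

Lemma similarity_setC A : f @` (~` A) = ~` (f @` A).
Proof.
apply/seteqP; split => [_ [x nAx <-] [y Ay /similarity_inj yx]|y nfA].
  by apply: nAx; rewrite -yx.
have [x xy] := similarity_surj y; exists x => // Ax.
by apply: nfA; exists x.
Qed.

Lemma similarity_closed A : closed A -> closed (f @` A).
Proof.
move=> cA; rewrite -[A]setCK similarity_setC; apply: open_closedC.
by apply: similarity_open; exact: closed_openC.
Qed.

Lemma similarity_closure A : closure (f @` A) `<=` f @` closure A.
Proof.
have clfA : closed (f @` closure A) by apply/similarity_closed/closed_closure.
rewrite [X in _ `<=` X](proj1 (closure_id _) clfA); apply: closure_subset.
by apply: image_subset; exact: subset_closure.
Qed.

End One.
End Similarity.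

(** * Words *)

Section Words.
Context {R : realType} {d N : nat}.
Local Notation V := 'rV[R]_d.
Local Notation D := (d.+1%:R : R).
Variables (phi : 'I_N -> V -> V) (r : 'I_N -> R).
Hypothesis phi_sim : forall i, similarity (r i) (phi i).
Hypothesis r_lt1 : forall i, r i < 1.
Implicit Types (s t w : seq 'I_N) (A B O F : set V).

Definition ratio s : R := \prod_(i <- s) r i.

Definition incomparable s t : bool := ~~ prefix s t && ~~ prefix t s.

Lemma word_map_cat s t x :
  word_map phi (s ++ t) x = word_map phi s (word_map phi t x).
Proof. by elim: s => //= i s ->. Qed.

Lemma ratio_cat s t : ratio (s ++ t) = ratio s * ratio t.
Proof. exact: big_cat. Qed.

Lemma ratio_cons i s : ratio (i :: s) = r i * ratio s.
Proof. exact: big_cons. Qed.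

Lemma ratio_gt0 s : 0 < ratio s.
Proof. by apply: prodr_gt0 => i _; exact: (proj1 (phi_sim i)). Qed.

Lemma ratio_le1 s : ratio s <= 1.
Proof.
apply: prodr_ile1 => i _; rewrite ltW ?(proj1 (phi_sim i))//=.
exact: ltW.
Qed.

Lemma ratio_cons_lt1 i s : ratio (i :: s) < 1.
Proof.
rewrite ratio_cons (le_lt_trans _ (r_lt1 i))// ler_piMr ?ratio_le1//.
by rewrite ltW// (proj1 (phi_sim i)).
Qed.

Lemma word_map_similarity s : similarity (ratio s) (word_map phi s).
Proof.
split; first exact: ratio_gt0.
elim: s => [|i s IH] x y /=; first by rewrite /ratio big_nil mul1r.
by rewrite (proj2 (phi_sim i)) IH ratio_cons mulrA.
Qed.

Lemma ratio_lbound : exists2 a : R, 0 < a <= 1 & forall i, a <= r i.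
Proof.
exists (\big[Num.min/1]_i r i); last by move=> i; exact: bigmin_le.
rewrite bigmin_le_id andbT; apply: lt_bigmin => // i _.
exact: (proj1 (phi_sim i)).
Qed.

Lemma ratio_ubound :
  exists2 q : R, 0 < q < 1 & forall s, ratio s <= q ^+ size s.
Proof.
(* Starting the maximum at 1/2 keeps [q] positive even for an empty family of maps. *)
pose q := \big[Num.max/(2^-1 : R)]_i r i.
have q0 : 0 < q by apply: lt_le_trans (bigmax_ge_id _ _ _ _); rewrite invr_gt0.
have q1 : q < 1.
  by apply: bigmax_lt => [|i _]; [rewrite invf_lt1// ltr1n|exact: r_lt1].
exists q; first by rewrite q0.
elim=> [|i s IH]; first by rewrite /ratio big_nil expr0.
rewrite ratio_cons exprS; apply: ler_pM => //; rewrite ?(ltW (ratio_gt0 _))//.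
  by rewrite ltW// (proj1 (phi_sim i)).
exact: le_bigmax.
Qed.

Lemma word_map_stable B s x :
  Phi phi B `<=` B -> B x -> B (word_map phi s x).
Proof.
move=> PB Bx; elim: s => //= i s IH; apply: PB.
by exists i => //; exists (word_map phi s x).
Qed.

Lemma incomparable_split s t : incomparable s t ->
  exists u i j v w, [/\ i != j, s = u ++ i :: v & t = u ++ j :: w].
Proof.
rewrite /incomparable.
elim: s t => [|i s IH] [|j t] //=; rewrite ?prefix0s ?andbF//.
rewrite [j == i]eq_sym; have [->|ij] := eqVneq i j; last first.
  by move=> _; exists [::], i, j, s, t.
move=> /IH[u [i' [j' [v [w [ij' -> ->]]]]]].
by exists (j :: u), i', j', v, w.
Qed.

(** After cancelling the common prefix, the two words begin with different letters [i] and [j], and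
    the points lie in the disjoint sets [phi i @] O[and]phi j @[O]. *)
Lemma incomparable_disjoint O s t x y : feasible_open_set phi O ->
  incomparable s t -> O x -> O y -> word_map phi s x <> word_map phi t y.
Proof.
move=> [_ _ PO dO] /incomparable_split[u [i [j [v [w [ij -> ->]]]]]] Ox Oy.
rewrite !word_map_cat /= => /(similarity_inj (word_map_similarity u)) e.
have : (phi i @` O `&` phi j @` O) (phi i (word_map phi v x)).
  split; first by exists (word_map phi v x) => //; exact: word_map_stable.
  by rewrite e; exists (word_map phi w y) => //; exact: word_map_stable.
by rewrite dO.
Qed.

Lemma expr_lt_eps (q C e : R) : 0 < q < 1 -> 0 < e -> exists n, C * q ^+ n < e.
Proof.
move=> /andP[q0 q1] e0; have [C0|C0] := ltP 0 C; last first.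
  exists 0%N; rewrite expr0 mulr1; exact: le_lt_trans e0.
have qn : `|q| < 1 by rewrite gtr0_norm.
have /cvgrPdist_lt/(_ (e / C) (divr_gt0 e0 C0))[n _ /(_ n (leqnn n))] := cvg_expr qn.
rewrite /= sub0r normrN gtr0_norm ?exprn_gt0// ltr_pdivlMr// mulrC => ?.
by exists n.
Qed.

(* Iterating the hypothesis writes a point of [A] as [phi_w y] with [w] long
   and [y] in the bounded set [A], hence close to [phi_w b] in [B]. *)
Lemma sub_closure_iter A B (M : R) : (forall x, A x -> `|x| <= M) -> B !=set0 ->
  Phi phi B `<=` B -> A `<=` B `|` Phi phi A -> A `<=` closure B.
Proof.
move=> AM [b Bb] PB AB.
have step n x : A x -> B x \/
    exists w y, [/\ size w = n, A y & x = word_map phi w y].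
  elim: n x => [|n IH] x Ax; first by right; exists [::], x.
  have [Bx|[i _ [y Ay <-]]] := AB _ Ax; first by left.
  have [By|[w [z [wn Az ->]]]] := IH _ Ay.
    by left; apply: PB; exists i => //; exists y.
  by right; exists (i :: w), z; split => //=; rewrite wn.
have [q q01 rq] := ratio_ubound.
move=> x Ax; apply/rV_closureP => e e0.
have [n nE] := expr_lt_eps (D * (M + `|b|)) q01 e0.
have [Bx|[w [y [wn Ay ->]]]] := step n x Ax.
  by exists x => //; rewrite subrr normr0.
exists (word_map phi w b); first exact: word_map_stable.
rewrite (le_lt_trans (similarity_upper (word_map_similarity w) _ _))//.
apply: le_lt_trans nE; rewrite mulrAC; apply: ler_pM => //.
- exact: ltW (ratio_gt0 _).
- rewrite ler_wpM2l// (le_trans (ler_normB _ _))// lerD2r; exact: AM.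
- by rewrite -wn.
Qed.

End Words.

(** * Packings by incomparable words *)

Section Packing.
Context {R : realType} {d N : nat}.
Local Notation V := 'rV[R]_d.
Local Notation D := (d.+1%:R : R).

(** Pigeonhole on the cube of radius [C]: [code] names the half-open grid cell of side [c] that
    contains a point, and two points of one cell are at sup distance less than [c]. *)
Lemma separated_size_bound (C c : R) : 0 < c -> exists M : nat, forall s : seq V,
  all (fun x => `|x| <= C) s -> pairwise (fun x y => c <= `|x - y|) s ->
  (size s <= M)%N.
Proof.
move=> c0; pose K := Num.truncn (2 * C / c).
pose code (x : V) : {ffun 'I_d -> 'I_K.+1} :=
  [ffun j => inord (Num.truncn ((x 0 j + C) / c))].
exists #|{ffun 'I_d -> 'I_K.+1}| => s sC sep.
suff /card_uniqP : uniq (map code s) by rewrite size_map => <-; exact: max_card.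
rewrite uniq_pairwise pairwise_map; apply: sub_in_pairwise sC sep => x y xC yC /=.
rewrite leNgt; apply: contra => /eqP /ffunP xy.
have bound (z : V) j : `|z| <= C -> 0 <= (z 0 j + C) / c <= 2 * C / c.
  move=> zC; have := le_trans (rV_coord_le z j) zC; rewrite ler_norml => /andP[? ?].
  rewrite divr_ge0 ?(ltW c0)//=; last lra.
  by rewrite ler_wpM2r ?invr_ge0 ?(ltW c0)//; lra.
apply: rV_norm_lt => // j; move: (xy j); rewrite !ffunE !mxE.
move: (bound x j xC) (bound y j yC) => /andP[x0 x1] /andP[y0 y1].
move=> /(congr1 (@nat_of_ord _)); rewrite !inordK ?ltnS ?le_truncn// => txy.
move: (truncn_itv x0) (truncn_itv y0); rewrite -txy -natr1 => /andP[? ?] /andP[? ?].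
rewrite -(ltr_pM2r (x := c^-1)) ?invr_gt0// mulfV ?gt_eqF//.
rewrite -[c^-1]gtr0_norm ?invr_gt0// -normrM mulrBl.
move: (x1) (y1); rewrite ltr_norml !mulrDl in x0 y0 *; lra.
Qed.

Variables (phi : 'I_N -> V -> V) (r : 'I_N -> R).
Hypothesis phi_sim : forall i, similarity (r i) (phi i).
Hypothesis r_lt1 : forall i, r i < 1.
Implicit Types (k t u v w : seq 'I_N) (s : seq (seq 'I_N)).
Local Notation ratio := (ratio r).

Section Fixed.
Variables (a C : R) (x0 : V).
Hypothesis a01 : 0 < a <= 1.
Hypothesis ar : forall i, a <= r i.

(** The copy of the set under [t] has about the size of the copy under [k] and lies near it on that
    scale; [x0] serves as a reference point for positions. Both conditions are invariant under a
    common prefix. *)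
Definition neighbour k t : bool :=
  (a * ratio k <= ratio t <= ratio k)
  && (edist (word_map phi t x0) (word_map phi k x0) <= C * ratio k).

Definition packing k s : bool := all (neighbour k) s && pairwise incomparable s.

Lemma neighbour_cat u k t : neighbour k t -> neighbour (u ++ k) (u ++ t).
Proof.
move=> /andP[/andP[h1 h2] h3]; rewrite /neighbour !ratio_cat !word_map_cat.
have u0 := ratio_gt0 phi_sim u.
rewrite (proj2 (word_map_similarity phi_sim u)) ![_ * (ratio u * _)]mulrCA.
by rewrite !ler_pM2l// h1 h2.
Qed.

Lemma packing_cat u k s : packing k s -> packing (u ++ k) (map (cat u) s).
Proof.
move=> /andP[/allP nb ps]; apply/andP; split.
  by apply/allP => _ /mapP[t /nb kt ->]; exact: neighbour_cat.
rewrite pairwise_map; apply: sub_pairwise ps => t t'.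
by rewrite /incomparable/= !prefix_catr// eqxx.
Qed.

(** Rescaled by the inverse of [ratio k], the points [word_map phi t y0] with [y0] in [O] stay in a
    fixed ball. They are uniformly separated, because each is surrounded by the image of a ball in
    [O] and these images are disjoint for incomparable words. *)
Lemma packing_size_bound O : feasible_open_set phi O ->
  exists M : nat, forall k s, packing k s -> (size s <= M)%N.
Proof.
move=> fO; have [[y0 Oy0] oO _ _] := fO.
have [e e0 eO] := proj1 (rV_openP O) oO _ Oy0.
have D0 : 0 < D by [].
have ae0 : 0 < a * e / D by rewrite divr_gt0// mulr_gt0//; case/andP: a01.
have [M MP] := separated_size_bound (D * `|y0 - x0| + C) ae0.
exists M => k s /andP[nb ps].
pose p t := (ratio k)^-1 *: (word_map phi t y0 - word_map phi k x0).
have k0 := ratio_gt0 phi_sim k.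
have nk0 : `|(ratio k)^-1| = (ratio k)^-1 by rewrite gtr0_norm// invr_gt0.
rewrite -(size_map p); apply: MP.
  rewrite all_map; apply: sub_all nb => t /andP[/andP[h1 h2] h3] /=.
  rewrite /p normrZ nk0 mulrC ler_pdivrMr//.
  rewrite (_ : _ - _ = (word_map phi t y0 - word_map phi t x0)
    + (word_map phi t x0 - word_map phi k x0)); last by rewrite addrA subrK.
  rewrite (le_trans (ler_normD _ _))// [leRHS]mulrDl lerD//.
    rewrite (le_trans (similarity_upper (word_map_similarity phi_sim t) _ _))//.
    by rewrite mulrAC ler_wpM2l// mulr_ge0.
  by rewrite (le_trans (norm_le_edist _ _)).
rewrite pairwise_map; apply: sub_in_pairwise nb ps.
move=> t t' /andP[/andP[h1 h2] _] _ /= tt'.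
(* Pulled back through [t], the other point falls outside [O], hence at distance at least [e] from
   [y0]. *)
have [x xE] := similarity_surj (word_map_similarity phi_sim t) (word_map phi t' y0).
have xO : e <= `|y0 - x|.
  rewrite leNgt; apply/negP => /eO Ox.
  exact: (incomparable_disjoint phi_sim fO tt' Ox Oy0 xE).
rewrite /p -scalerBr opprB addrA subrK normrZ nk0 [leRHS]mulrC ler_pdivlMr// mulrAC ler_pdivrMr//.
have := similarity_lower (word_map_similarity phi_sim t) y0 x.
rewrite xE [leRHS]mulrC; apply: le_trans; rewrite mulrAC.
by apply: ler_pM => //; rewrite ?mulr_ge0 ?(ltW k0) ?(ltW e0)//; case/andP: a01 => /ltW.
Qed.

(** The maximum is taken over the centres as well, so a packing around a longer word [u ++ k] cannot
    be larger. *)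
Lemma exists_max_packing O : feasible_open_set phi O ->
  exists k s, packing k s /\ forall k' s', packing k' s' -> (size s' <= size s)%N.
Proof.
move=> /packing_size_bound[M MP].
pose P n := `[< exists k s, packing k s /\ size s = n >].
have P0 : exists n, P n by exists 0%N; apply/asboolP; exists [::], [::].
have PM n : P n -> (n <= M)%N by move=> /asboolP[k [s [/MP sM <-]]].
case: (ex_maxnP P0 PM) => n /asboolP[k [s [ks <-]]] smax.
exists k, s; split => // k' s' ks'; apply: smax.
by apply/asboolP; exists k', s'.
Qed.

(** Take the shortest prefix with ratio at most [b]: its last letter lowers the ratio by a factor no
    smaller than [a]. The empty prefix is excluded, since its ratio 1 exceeds [b]. *)
Lemma word_cut w (b : R) : ratio w <= b -> b < 1 ->
  exists u v, [/\ w = u ++ v, u != [::] & a * b <= ratio u <= b].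
Proof.
elim: w b => [|i w IH] b.
  by rewrite /ratio big_nil => /le_lt_trans/[apply]; rewrite ltxx.
rewrite ratio_cons => wb b1; have [a0 a1] := andP a01.
have ri0 := proj1 (phi_sim i).
have b0 : 0 < b by rewrite (lt_le_trans _ wb)// mulr_gt0// (ratio_gt0 phi_sim).
have [rib|bri] := leP (r i) b.
  exists [:: i], w; split => //; rewrite ratio_cons /ratio big_nil mulr1 rib andbT.
  by rewrite (le_trans _ (ar i))// ler_piMr// ltW.
have [||u [v [-> u0 /andP[h1 h2]]]] := IH (b / r i).
- by rewrite ler_pdivlMr// mulrC.
- by rewrite ltr_pdivrMr// mul1r.
exists (i :: u), v; split => //; rewrite ratio_cons; apply/andP; split.
  by rewrite [leRHS]mulrC -ler_pdivrMr// -mulrA.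
by rewrite mulrC -ler_pdivlMr.
Qed.

End Fixed.

(* Schief's maximality argument: if two images met, the prefix [w] of the longer
   word whose ratio is comparable to that of the shorter one would enlarge a
   translate of the maximal packing around [k]. *)
Lemma exists_separating_word F (U : set V) (M : R) :
  open_set_condition phi -> F !=set0 -> Phi phi F `<=` F ->
  (forall x, F x -> `|x| <= M) -> (forall x, U x -> `|x| <= M) ->
  exists k, forall i j u v x y, i != j -> U x -> U y ->
    word_map phi ((i :: u) ++ k) x <> word_map phi ((j :: v) ++ k) y.
Proof.
move=> [W fW] [x0 Fx0] PF FM UM.
have [a a01 ar] := ratio_lbound phi_sim.
(* Three moves of sup length at most [D * (2 * M) * ratio p] will lead from the reference point of
   [w] to that of [p]; the outer [D] converts to Euclidean distance. *)
pose C := D * (D * (6 * M)).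
have [k [s [ks smax]]] := exists_max_packing C x0 a01 fW.
exists k.
(* By symmetry, the second word may be assumed to have the smaller ratio. *)
suff main i j u v x y : i != j -> U x -> U y ->
    ratio ((j :: v) ++ k) <= ratio ((i :: u) ++ k) ->
    word_map phi ((i :: u) ++ k) x <> word_map phi ((j :: v) ++ k) y.
  move=> i j u v x y ij Ux Uy.
  have [pq|qp] := leP (ratio ((j :: v) ++ k)) (ratio ((i :: u) ++ k)).
    exact: main.
  by move/esym; apply: main => //; rewrite 1?eq_sym// ltW.
set p := (i :: u) ++ k; set q := (j :: v) ++ k => ij Ux Uy qp e.
have [w [z [qwz w0 wp]]] := word_cut a01 ar qp (ratio_cons_lt1 phi_sim r_lt1 _ _).
(* Being nonempty, [w] starts with [j], which makes it incomparable with every word starting with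
   [i]. *)
have [z' wE] : exists z', w = j :: z'.
  by case: w qwz w0 {wp} => // j' z' [-> _] _; exists z'.
have M0 : 0 <= M := le_trans (normr_ge0 _) (FM _ Fx0).
have near t b b' : `|b| <= M -> `|b'| <= M -> ratio t <= ratio p ->
    `|word_map phi t b - word_map phi t b'| <= D * (2 * M) * ratio p.
  move=> bM b'M tp.
  rewrite (le_trans (similarity_upper (word_map_similarity phi_sim t) _ _))//.
  rewrite mulrAC; apply: ler_pM => //; first exact: ltW (ratio_gt0 phi_sim _).
  by rewrite ler_wpM2l// (le_trans (ler_normB _ _))//; lra.
have pw : neighbour a C x0 p w.
  rewrite /neighbour wp/= (le_trans (edist_le_norm _ _))// -mulrA ler_wpM2l//.
  set A := word_map phi w x0; set B := word_map phi p x0.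
  (* The route passes through the supposed common point of the two images, where the map of [q] at
     [y] equals that of [p] at [x]. *)
  rewrite (_ : A - B = (A - word_map phi q x0)
    + (word_map phi q x0 - word_map phi q y) + (word_map phi p x - B)); last first.
    by rewrite e !addrA !subrK.
  rewrite (le_trans (ler_normD _ _))//.
  apply: le_trans (lerD (ler_normD _ _) (lexx _)) _.
  have n1 : `|A - word_map phi q x0| <= D * (2 * M) * ratio p.
    rewrite qwz word_map_cat; apply: near; first exact: FM.
      by apply: FM; exact: word_map_stable.
    by case/andP: wp.
  have n2 := near q x0 y (FM _ Fx0) (UM _ Uy) qp.
  have n3 := near p x x0 (UM _ Ux) (FM _ Fx0) (lexx _).
  apply: le_trans (lerD (lerD n1 n2) n3) _.
  by rewrite le_eqVlt; apply/orP; left; apply/eqP; ring.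
have bigger : packing a C x0 p (w :: map (cat (i :: u)) s).
  have /andP[nb ps] := packing_cat (i :: u) ks.
  rewrite /packing /= pw nb ps !andbT /= all_map; apply/allP => t _ /=.
  by rewrite wE /incomparable /= eq_sym (negbTE ij).
by have := smax _ _ bigger; rewrite /= size_map ltnn.
Qed.

End Packing.
(** * Minkowski dimension of sets with interior *)

Section Minkowski.
Context {R : realType} {d : nat}.
Local Notation V := 'rV[R]_d.
Local Notation D := (d.+1%:R : R).
Implicit Types (A : set V) (delta M e : R).

(** The centres form a grid of mesh [delta / D] on the cube of radius [M]; rounding down each
    coordinate costs at most [delta / D] in sup norm, hence at most [delta] in Euclidean
    distance. *)
Lemma covered_by_ball_grid A M delta : 0 < delta -> (forall x, A x -> `|x| <= M) ->
  covered_by_balls A delta ((Num.truncn (2 * M * D / delta)).+1 ^ d).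
Proof.
move=> de0 AM; set m := (Num.truncn _).+1.
pose T : finType := {ffun 'I_d -> 'I_m}.
have cT : #|T| = (m ^ d)%N by rewrite card_ffun !card_ord.
rewrite -cT; have D0 : 0 < D by [].
have st : 0 < delta / D by exact: divr_gt0.
exists (fun i => \row_j (- M + delta / D * ((enum_val i : T) j)%:R)) => x /AM xM.
have bound j : 0 <= (x 0 j + M) / (delta / D) <= 2 * M * D / delta.
  have := le_trans (rV_coord_le x j) xM; rewrite ler_norml => /andP[? ?].
  rewrite divr_ge0 ?(ltW st)//=; last lra.
  by rewrite -[leRHS]mulrA -[D / delta]invf_div ler_wpM2r ?invr_ge0 ?(ltW st)//; lra.
pose g : T := [ffun j => inord (Num.truncn ((x 0 j + M) / (delta / D)))].
exists (enum_rank g) => //=; rewrite enum_rankK.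
rewrite (le_trans (edist_le_norm _ _))// mulrC -ler_pdivlMr//.
apply: rV_norm_le => [|j]; first exact: ltW.
have /andP[b0 b1] := bound j.
rewrite !mxE ffunE inordK ?ltnS ?le_truncn//.
have := truncn_itv b0; rewrite -[(Num.truncn _).+1%:R]natr1 => /andP[].
rewrite ler_pdivlMr// ltr_pdivrMr// distrC.
set t : R := (Num.truncn _)%:R; set s := delta / _ => h1 h2.
clearbody t; clear b0 b1 bound g; clearbody s.
by rewrite ger0_norm; lra.
Qed.

Lemma natr_dist_lt1 (p q : nat) : `|p%:R - q%:R : R| < 1 -> p = q.
Proof.
rewrite -[p%:R]/(p%:Z%:~R) -[q%:R]/(q%:Z%:~R) -intrB -intr_norm -[1]/(1%:~R).
by rewrite ltr_int; lia.
Qed.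

(** The ball around [c] contains [m ^ d] grid points of mesh [3 * delta], and a ball of radius
    [delta] contains at most one of them, as its diameter is only [2 * delta]. *)
Lemma grid_le_covered A (c : V) e delta n m : 0 < delta ->
  (forall y, `|c - y| < e -> A y) -> covered_by_balls A delta n ->
  m%:R * (3 * delta) <= e -> 0 < e -> (m ^ d <= n)%N.
Proof.
move=> de0 eA [b Ab] me e0.
pose x (g : {ffun 'I_d -> 'I_m}) : V := \row_j (c 0 j + 3 * delta * (g j)%:R).
have xA g : A (x g).
  apply: eA; apply: rV_norm_lt => // j; rewrite !mxE opprD addrA subrr sub0r normrN.
  rewrite ger0_norm ?mulr_ge0 ?(ltW de0)//; apply: lt_le_trans me.
  by rewrite mulrC ltr_pM2r ?mulr_gt0// ltr_nat.
have /choice[f fE] g : exists i, edist (b i) (x g) <= delta.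
  by have [i _ ?] := Ab _ (xA g); exists i.
rewrite -[X in (_ <= X)%N]card_ord -[m]card_ord -[X in (_ ^ X)%N]card_ord -card_ffun.
apply: (leq_card f) => g h gh; apply/ffunP => j.
have near k : `|b (f k) 0 j - x k 0 j| <= delta.
  have := le_trans (rV_coord_le (b (f k) - x k) j) (le_trans (norm_le_edist _ _) (fE k)).
  by rewrite !mxE.
have := le_trans (ler_normB (b (f g) 0 j - x g 0 j) (b (f h) 0 j - x h 0 j))
  (lerD (near g) (near h)).
rewrite gh !mxE.
set u := _ - _ ; have -> : u = 3 * delta * ((h j)%:R - (g j)%:R) by rewrite /u; ring.
rewrite normrM ger0_norm ?mulr_ge0 ?(ltW de0)// => hg.
have : `|(h j)%:R - (g j)%:R : R| < 1.
  rewrite -(ltr_pM2l (x := 3 * delta)) ?mulr_gt0//; apply: le_lt_trans hg _.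
  by move: de0; clear; lra.
by move=> hg1; apply/val_inj/esym/(natr_dist_lt1 hg1).
Qed.

(** For [delta <= e / 6] the number [e / (3 * delta)] is at least 2, so rounding it down loses at
    most half. For [delta <= 1] the 1 added in rounding up is absorbed by [1 / delta]. *)
Lemma covering_number_bounds A (c : V) M e : 0 < e -> 0 <= M ->
  (forall x, A x -> `|x| <= M) -> (forall y, `|c - y| < e -> A y) ->
  forall delta, 0 < delta -> delta <= 1 -> delta <= e / 6 ->
  (e / 6 / delta) ^+ d <= covering_number A delta <= ((2 * M * D + 1) / delta) ^+ d.
Proof.
move=> e0 M0 AM eA delta de0 de1 dee.
have cov := covered_by_ball_grid de0 AM.
have MD0 : 0 <= 2 * M * D / delta by rewrite divr_ge0 ?mulr_ge0// ltW.
apply/andP; split.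
  apply: lb_le_inf; first by eexists; eexists; [exact: cov|].
  move=> _ [n /= An <-].
  pose m := Num.truncn (e / (3 * delta)).
  have e3 : 0 <= e / (3 * delta) by rewrite divr_ge0 ?mulr_ge0// ltW.
  have /andP[m1 m2] := truncn_itv e3.
  have mn : (m ^ d <= n)%N.
    apply: (grid_le_covered de0 eA An) => //.
    by rewrite -ler_pdivlMr ?mulr_gt0.
  apply: (@le_trans _ _ ((m ^ d)%:R)); last by rewrite ler_nat.
  rewrite natrX lerXn2r ?nnegrE ?divr_ge0 ?(ltW e0) ?(ltW de0)//.
  move: m2; rewrite -[(Num.truncn _).+1%:R]natr1 -/m => m2.
  have e61 : 1 <= e / 6 / delta by rewrite ler_pdivlMr// mul1r.
  have E : e / (3 * delta) = 2 * (e / 6 / delta) by field; rewrite gt_eqF.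
  by move: m2; rewrite E; lra.
apply: (@le_trans _ _ (((Num.truncn (2 * M * D / delta)).+1 ^ d)%:R)).
  apply: ge_inf; last by exists ((Num.truncn (2 * M * D / delta)).+1 ^ d)%N.
  by exists 0 => _ [n _ <-].
rewrite natrX lerXn2r ?nnegrE ?divr_ge0 ?addr_ge0 ?mulr_ge0 ?(ltW de0)//.
rewrite -[(Num.truncn _).+1%:R]natr1 [leRHS]mulrDl lerD//; first by case/andP: (truncn_itv MD0).
by rewrite ler_pdivlMr// mul1r.
Qed.

(** For [delta] in (0, 1) the quotient equals [d * (1 - ln a / ln delta)], and [ln delta] tends to
    minus infinity. *)
Lemma ln_ratio_cvg (a : R) : 0 < a ->
  (ln ((a / delta) ^+ d) / - ln delta) @[delta --> 0^'+] --> (d%:R : R).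
Proof.
move=> a0.
have V0 : (fun x : R => (ln x)^-1) @ 0^'+ --> (0 : R).
  apply: (proj2 (ltr0_cvgV0 _)) => /=; last exact: lnNy.
  near=> x; have x0 : 0 < x by near: x; exact: nbhs_right_gt.
  have x1 : x < 1 by near: x; exact: nbhs_right_lt.
  by rewrite ln_lt0// x0.
have L : (fun x : R => d%:R * (1 - ln a * (ln x)^-1)) @ 0^'+
    --> (d%:R * (1 - ln a * 0) : R).
  apply: cvgMl_tmp; apply: cvgB; first exact: cvg_cst.
  exact: cvgMl_tmp.
rewrite mulr0 subr0 mulr1 in L; apply: cvg_trans L; apply: near_eq_cvg; near=> x.
have x0 : 0 < x by near: x; exact: nbhs_right_gt.
have x1 : x < 1 by near: x; exact: nbhs_right_lt.
have lx : ln x != 0 by rewrite lt_eqF// ln_lt0// x0.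
by rewrite lnXn ?divr_gt0// ln_div ?posrE// -mulr_natl; field.
Unshelve. all: by end_near. Qed.

Lemma minkowski_dim_interior A M : (forall x, A x -> `|x| <= M) ->
  interior A !=set0 -> minkowski_dim A = d%:R.
Proof.
move=> AM [c /rV_nbhsP[e e0 eA]].
have M0 : 0 <= M.
  by apply: le_trans (AM c _) => //; apply: eA; rewrite subrr normr0.
apply/cvg_lim => //.
have K0 : 0 < 2 * M * D + 1 by rewrite ltr_wpDl// mulr_ge0// mulr_ge0.
have e6 : 0 < e / 6 by rewrite divr_gt0.
apply: (squeeze_cvgr _ (ln_ratio_cvg e6) (ln_ratio_cvg K0)).
near=> x.
have x0 : 0 < x by near: x; exact: nbhs_right_gt.
have x1 : x < 1 by near: x; exact: nbhs_right_lt.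
have xe : x < e / 6 by near: x; exact: nbhs_right_lt.
have /andP[b1 b2] := covering_number_bounds e0 M0 AM eA x0 (ltW x1) (ltW xe).
have p1 : 0 < (e / 6 / x) ^+ d by rewrite exprn_gt0// divr_gt0.
have pc := lt_le_trans p1 b1; have pK := lt_le_trans pc b2.
have lx : 0 < (- ln x)^-1 by rewrite invr_gt0 oppr_gt0 ln_lt0// x0.
by rewrite !ler_pM2r// !ler_ln ?posrE// b1.
Unshelve. all: by end_near. Qed.

End Minkowski.
(** * Bounded complementary pieces *)

Section Holes.
Context {R : realType} {d : nat}.
Local Notation V := 'rV[R]_d.
Implicit Types (x y : V) (F W U : set V).

(** The parameters in [0, 1] whose points lie in [W] form a nonempty, relatively open and relatively
    closed set, closed because the remaining parameters lead into [U]. *)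
Lemma segment_in_open W U x y : open W -> open U -> W `&` U = set0 -> W x ->
  (forall t : R, 0 <= t <= 1 -> (W `|` U) (x + t *: (y - x))) -> W y.
Proof.
move=> oW oU WU Wx seg.
have pre A : open A -> open [set t : R | A (x + t *: (y - x))].
  move=> /rV_openP oA; rewrite openE => t /oA[e e0 eA]; apply/nbhs_normP.
  exists (e / (`|y - x| + 1)) => [|s /= ts]; first by rewrite /= divr_gt0// ltr_wpDl.
  apply: eA; rewrite opprD addrA [x + _]addrC addrK -scalerBl normrZ.
  move: ts; rewrite ltr_pdivlMr ?ltr_wpDl//; apply: le_lt_trans.
  by rewrite ler_wpM2l// lerDl.
have conn : connected `[(0 : R), 1] by apply/connected_intervalP; exact: interval_is_interval.
pose B := `[(0 : R), 1]%classic `&` [set t | W (x + t *: (y - x))].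
suff : B = `[(0 : R), 1]%classic.
  move=> BE; have : B 1 by rewrite BE /= in_itv /= lexx ler01.
  by case=> _ /=; rewrite scale1r addrC subrK.
apply: conn.
- by exists 0; split => /=; rewrite ?in_itv/= ?lexx ?ler01// scale0r addr0.
- by exists [set t | W (x + t *: (y - x))] => //; exact: pre.
- exists (~` [set t | U (x + t *: (y - x))]).
    by apply: open_closedC; exact: pre.
  apply/seteqP; split => t [/= t01 h]; split => //=.
    by move=> Ut; have : set0 (x + t *: (y - x)) by rewrite -WU.
  by have [] := seg t; rewrite -?[_ <= _ <= _]/(t \in `[0, 1]) ?in_itv.
Qed.

(* The complement of a sup-norm ball is the union of the open half-spaces
   [M < (-1)^b * x_i]; they are convex, and for [2 <= d] any two of them are
   linked by at most one intermediate half-space. *)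
Lemma bounded_separation F W U (M : R) : (2 <= d)%N ->
  (forall x, F x -> `|x| <= M) -> open W -> open U -> W `&` U = set0 ->
  ~` F `<=` W `|` U ->
  (forall x, W x -> `|x| <= M) \/ (forall x, U x -> `|x| <= M).
Proof.
move=> d2 FM oW oU WU FWU.
pose H (i : 'I_d) (b : bool) := [set x : V | M < (-1) ^+ b * x 0 i].
have HWU i b x : H i b x -> (W `|` U) x.
  move=> Hx; apply: FWU => /FM; rewrite leNgt => /negP; apply.
  apply: lt_le_trans (rV_coord_le x i); apply: lt_le_trans Hx _.
  by rewrite (le_trans (ler_norm _))// normrM normrX normrN1 expr1n mul1r.
have HW i b x y : H i b x -> H i b y -> W x -> W y.
  move=> Hx Hy Wx; apply: (segment_in_open oW oU WU Wx) => t /andP[t0 t1].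
  apply: (HWU i b); rewrite /H /= !mxE.
  rewrite (_ : _ * _ = (1 - t) * ((-1) ^+ b * x 0 i) + t * ((-1) ^+ b * y 0 i)); last ring.
  move: Hx Hy; rewrite /H /=; move: (_ * _) (_ * _) => p q Hx Hy.
  have [->|t0'] := eqVneq t 0; first by rewrite subr0 mul1r mul0r addr0.
  have tp : 0 < t by rewrite lt_neqAle eq_sym t0'.
  rewrite (_ : M = (1 - t) * M + t * M); last ring.
  by rewrite ler_ltD// ?ltr_pM2l// ler_wpM2l ?subr_ge0// ltW.
have big x : ~ (`|x| <= M) -> exists i b, H i b x.
  move=> xM; apply: contrapT => /forallNP nH; apply: xM.
  have nHx i : `|x 0 i| <= M.
    rewrite ler_norml lerNl; apply/andP; split; rewrite leNgt; apply/negP => h.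
      by apply: (nH i); exists true; rewrite /H /= expr1 mulN1r.
    by apply: (nH i); exists false; rewrite /H /= expr0 mul1r.
  apply: rV_norm_le => //; apply: le_trans (nHx (Ordinal d2)) => //.
have link i b j c : i != j -> exists z : V, H i b z /\ H j c z.
  move=> ij; exists (\row_k (if k == i then (-1) ^+ b * (M + 1) else (-1) ^+ c * (M + 1))).
  rewrite /H /= !mxE eqxx eq_sym (negbTE ij) !mulrA -!expr2 !sqrr_sign !mul1r.
  by rewrite ltrDl.
apply: contrapT => /not_orP[/existsNP[p /not_implyP[Wp pM]] /existsNP[q /not_implyP[Uq qM]]].
have [i [b Hp]] := big _ pM; have [j [c Hq]] := big _ qM.
have nW z : H j c z -> ~ W z.
  by move=> Hz Wz; have : set0 q by rewrite -WU; split => //; exact: HW Hz Hq Wz.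
have [ij|ij] := eqVneq i j; last first.
  have [z [z1 z2]] := link i b j c ij.
  exact: nW z2 (HW _ _ _ _ Hp z1 Wp).
(* On a common axis the two half-spaces may be opposite, so the link goes around through a second
   axis. *)
have [k ki] : exists k, i != k.
  have [i0|i0] := eqVneq (i : nat) 0%N.
    by exists (Ordinal d2); rewrite -val_eqE /= i0.
  by exists (Ordinal (ltnW d2)); rewrite -val_eqE.
have [z [z1 z2]] := link i b k true ki.
have kj : k != j by rewrite -ij eq_sym.
have [z' [z1' z2']] := link k true j c kj.
by apply: (nW _ z2'); exact: (HW _ _ _ _ z2 z1' (HW _ _ _ _ Hp z1 Wp)).
Qed.

(** Two separated pieces of the open set [F^c] are open, and one of them is bounded. Its closure
    misses the other piece, so it adds only points of [F]. *)
Lemma bounded_hole_dim_ge2 F (M : R) : (2 <= d)%N -> closed F ->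
  (forall x, F x -> `|x| <= M) -> ~ connected (~` F) ->
  exists W, [/\ W !=set0, open W, forall x, W x -> `|x| <= M & closure W `<=` W `|` F].
Proof.
move=> d2 cF FM /connectedPn[E [E0 FE [sep1 sep2]]].
have oE b : open (E b).
  have -> : E b = ~` F `&` ~` closure (E (~~ b)).
    rewrite FE; case: b => /=; apply/seteqP; split => x.
    - move=> Ex; split; [by right|] => clx.
      by have : set0 x by rewrite -sep1.
    - by move=> [[Ex|//] clx]; exfalso; apply/clx/subset_closure.
    - move=> Ex; split; [by left|] => clx.
      by have : set0 x by rewrite -sep2.
    - by move=> [[//|Ex] clx]; exfalso; apply/clx/subset_closure.
  by apply: openI; apply: closed_openC => //; exact: closed_closure.
have hole b : (forall x, E b x -> `|x| <= M) ->
    exists W, [/\ W !=set0, open W, forall x, W x -> `|x| <= M & closure W `<=` W `|` F].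
  move=> EM; exists (E b); split => // x clx.
  have [Fx|nFx] := pselect (F x); first by right.
  left; have : (~` F) x by [].
  rewrite FE; case: b clx {EM} => clx [] // Ex.
    by have : set0 x by rewrite -sep2.
  by have : set0 x by rewrite -sep1.
have E_disj : E false `&` E true = set0.
  apply/seteqP; split => // x [Ex Ex'].
  by rewrite -sep2; split => //; exact: subset_closure.
have E_cover : ~` F `<=` E false `|` E true by rewrite FE.
by case: (bounded_separation d2 FM (oE false) (oE true) E_disj E_cover); exact: hole.
Qed.

End Holes.

(** On the line both pieces of a separation of [F^c] can be unbounded. Instead, the part of [F^c]
    between two points of [F] serves: empty interior makes it nonempty, and the end points belong to
    [F]. *)
Lemma bounded_hole_dim1 (R : realType) (F : set 'rV[R]_1) (M : R) (x y : 'rV[R]_1) :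
  closed F -> (forall z, F z -> `|z| <= M) ->
  interior F = set0 -> F x -> F y -> x != y ->
  exists W, [/\ W !=set0, open W, forall z, W z -> `|z| <= M & closure W `<=` W `|` F].
Proof.
move=> cF FM F0; wlog xy : x y / x 0 0 < y 0 0 => [hw Fx Fy xy|Fx Fy _].
  have : x 0 0 != y 0 0.
    by apply: contraNneq xy => e; apply/eqP/rowP => i; rewrite (ord1 i).
  rewrite neq_lt => /orP[lt|lt]; first exact: hw lt Fx Fy xy.
  by apply: hw lt Fy Fx _; rewrite eq_sym.
pose I := [set z : 'rV[R]_1 | x 0 0 < z 0 0 < y 0 0].
have coord (z z' : 'rV[R]_1) (e : R) : `|z - z'| < e -> `|z 0 0 - z' 0 0| < e.
  by apply: le_lt_trans; have := rV_coord_le (z - z') 0; rewrite !mxE.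
have oI : open I.
  apply/rV_openP => z /andP[xz zy].
  exists (Num.min (z 0 0 - x 0 0) (y 0 0 - z 0 0)) => [|z' /coord].
    by rewrite lt_min !subr_gt0 xz.
  rewrite lt_min !ltr_norml /I /= => /andP[/andP[? ?] /andP[? ?]].
  by apply/andP; split; lra.
have mid : I (const_mx ((x 0 0 + y 0 0) / 2)).
  by rewrite /I /= mxE; apply/andP; split; lra.
exists (I `&` ~` F); split.
- apply: contrapT => /set0P/negP/negPn/eqP IF.
  have : set0 (const_mx ((x 0 0 + y 0 0) / 2) : 'rV[R]_1); last by [].
  rewrite -F0; apply: filterS (open_nbhs_nbhs (conj oI mid)) => z Iz.
  by apply: contrapT => nFz; have : set0 z by rewrite -IF.
- by apply: openI => //; exact: closed_openC.
- move=> z [/andP[xz zy] _].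
  have := le_trans (rV_coord_le _ 0) (FM _ Fx).
  have := le_trans (rV_coord_le _ 0) (FM _ Fy).
  rewrite !ler_norml => /andP[? ?] /andP[? ?].
  have zM : `|z 0 0| <= M by rewrite ler_norml; apply/andP; split; lra.
  by apply: rV_norm_le => [|j]; [exact: le_trans zM|rewrite (ord1 j)].
- move=> z clz; have [Fz|nFz] := pselect (F z); first by right.
  left; split => //.
  have ne w : F w -> w 0 0 != z 0 0.
    move=> Fw; apply: contra_notN nFz => /eqP e.
    by rewrite (_ : z = w)//; apply/rowP => i; rewrite (ord1 i).
  apply/andP; split; rewrite lt_neqAle.
    rewrite ne//= leNgt; apply/negP => zx.
    have [|w [/andP[xw _] _]] := proj1 (rV_closureP _ _) clz (x 0 0 - z 0 0).
      by rewrite subr_gt0.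
    by move=> /coord; rewrite ltr_norml => /andP[h _]; move: xw h; clear; lra.
  rewrite eq_sym ne//= leNgt; apply/negP => zx.
  have [|w [/andP[_ wy] _]] := proj1 (rV_closureP _ _) clz (z 0 0 - y 0 0).
    by rewrite subr_gt0.
  by move=> /coord; rewrite ltr_norml => /andP[_ h]; move: wy h; clear; lra.
Qed.

(** * Compatible tilings *)

Section Tilings.
Context {R : realType} {d N : nat}.
Local Notation V := 'rV[R]_d.
Variables (phi : 'I_N -> V -> V) (r : 'I_N -> R) (F : set V) (M : R).
Hypothesis N_ge2 : (2 <= N)%N.
Hypothesis phi_sim : forall i, similarity (r i) (phi i).
Hypothesis r_lt1 : forall i, r i < 1.
Hypotheses (F0 : F !=set0) (F_closed : closed F) (F_self : F = Phi phi F).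
Hypothesis F_bounded : forall x, F x -> `|x| <= M.

Let PF : Phi phi F `<=` F. Proof. by rewrite -F_self. Qed.
Let i0 : 'I_N := Ordinal (ltnW N_ge2).
Let i1 : 'I_N := Ordinal N_ge2.

Lemma attractor_sub_closure O : feasible_open_set phi O -> F `<=` closure O.
Proof.
move=> [neO _ PO _]; apply: (sub_closure_iter phi_sim r_lt1 F_bounded neO PO).
by rewrite -F_self => x; right.
Qed.

(* Were [O] dense, the open set [phi_0 O] would meet the dense set [phi_1 O]. *)
Lemma feasible_not_dense O : feasible_open_set phi O -> closure O <> setT.
Proof.
move=> [[p Op] oO _ dO] clO.
have [x xE] := similarity_surj (phi_sim i1) (phi i0 p).
have /rV_openP op := similarity_open_preimage (phi_sim i1) (similarity_open (phi_sim i0) oO).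
have [|e e0 eO] := op x; first by exists p.
have : closure O x by rewrite clO.
move=> /rV_closureP/(_ e e0)[y Oy /eO y0].
have : set0 (phi i1 y); last by [].
by rewrite -(dO i0 i1)//; split => //; exists y.
Qed.

Lemma compatible_disconnected :
  possesses_compatible_tiling phi F -> ~ connected (~` F).
Proof.
move=> [] O [T [[fO [g [gO nPg]] _] bO]] conn.
have [_ oO _ _] := fO; have FO := attractor_sub_closure fO.
have clO x : closure O x -> ~ F x -> O x.
  move=> clOx nFx; apply: contrapT => nOx; apply/nFx/bO; split => //.
  by rewrite (proj1 (interior_id _) oO).
(* [O] is relatively clopen in [F^c] because its boundary lies in [F]; connectedness would make it
   all of [F^c], and then [O] would be dense. *)
have E : ~` F `&` O = ~` F.
  apply: conn.
  - exists g; split => //; rewrite F_self => -[i _ [y Fy yg]].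
    by apply: nPg; exists i => //; exists y => //; exact: FO.
  - by exists O.
  - exists (closure O); first exact: closed_closure.
    apply/seteqP; split => x [nFx Ox]; split => //; first exact: subset_closure.
    exact: clO.
apply: (feasible_not_dense fO); apply/seteqP; split => // x _.
have [Fx|nFx] := pselect (F x); first exact: FO.
have : (~` F) x by [].
by rewrite -E => -[_ Ox]; exact: subset_closure.
Qed.

(** If [F] were a single point, all maps would fix it and, on the line, be scalings about it. They
    would commute, so [phi i0 (phi i1 p)] would lie in both of two disjoint images. *)
Lemma attractor_not_singleton_dim1 : d = 1%N -> open_set_condition phi ->
  exists x y, [/\ F x, F y & x != y].
Proof.
move=> d1 [W [[p Wp] _ PW dW]]; have [x Fx] := F0.
apply: contrapT => nF.
have Fx1 y : F y -> y = x.
  move=> Fy; apply: contrapT => /eqP yx; apply: nF; by exists y, x.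
have fix_x i : phi i x = x by apply/Fx1/PF; exists i => //; exists x.
have aff i : exists A : 'M[R]_d, forall u, phi i (x + u) = x + u *m A.
  have [A _ fA] := similarity_affine (phi_sim i); exists A => u.
  by rewrite fA mulmxDl addrA -fA fix_x.
have [A0 a0] := aff i0; have [A1 a1] := aff i1.
have AC : A0 *m A1 = A1 *m A0.
  move: A0 A1 {a0 a1}; rewrite d1 => A0 A1.
  by rewrite [A0]mx11_scalar scalar_mxC.
have comm : phi i0 (phi i1 p) = phi i1 (phi i0 p).
  by rewrite -[p](subrKC x) a1 a0 a0 a1 -!mulmxA AC.
have PWi i z : W z -> W (phi i z) by move=> Wz; apply: PW; exists i => //; exists z.
have : set0 (phi i0 (phi i1 p)); last by [].
rewrite -(dW i0 i1)//; split; first by exists (phi i1 p) => //; exact: PWi.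
by rewrite comm; exists (phi i0 p) => //; exact: PWi.
Qed.

Lemma compatible_of_hole (U : set V) : open_set_condition phi ->
  interior F = set0 -> U !=set0 -> open U -> (forall x, U x -> `|x| <= M) ->
  closure U `<=` U `|` F -> possesses_compatible_tiling phi F.
Proof.
move=> osc intF [u0 Uu0] oU UM clU.
have [k kP] := exists_separating_word phi_sim r_lt1 osc F0 PF F_bounded UM.
pose X := word_map phi k @` U.
pose O := \bigcup_(w in [set: seq 'I_N]) (word_map phi w @` X).
have OE w x : U x -> O (word_map phi (w ++ k) x).
  move=> Ux; exists w => //; exists (word_map phi k x); first by exists x.
  by rewrite word_map_cat.
have oX : open X by apply: (similarity_open (word_map_similarity phi_sim k)).
have O_open : open O.
  by apply: bigcup_open => w _; apply: (similarity_open (word_map_similarity phi_sim w)).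
have PO : Phi phi O `<=` O.
  move=> _ [i _ [_ [w _ [_ [x Ux <-] <-]] <-]].
  by rewrite -word_map_cat; exact: (OE (i :: w)).
have fO : feasible_open_set phi O.
  split => //; first by exists (word_map phi ([::] ++ k) u0); exact: OE.
  move=> i j ij; apply/seteqP; split => // z [].
  move=> [_ [w _ [_ [x Ux <-] <-]] <-] [_ [w' _ [_ [y Uy <-] <-]]].
  rewrite -!word_map_cat => /esym e.
  exact: (kP i j w w' x y ij Ux Uy).
(* Each point of [O] is compared with the image of a point [b] of [F] under the same word, which
   stays in [F]; the ratio is at most 1. *)
have O_bounded : exists K, forall x, O x -> `|x| <= K.
  have [b Fb] := F0; exists (d.+1%:R * (M + `|b|) + M) => x.
  move=> [w _ [_ [y Uy <-] <-]]; rewrite -word_map_cat.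
  set v := w ++ k.
  rewrite -[X in `|X|](subrK (word_map phi v b)) (le_trans (ler_normD _ _))// lerD//.
    rewrite (le_trans (similarity_upper (word_map_similarity phi_sim v) _ _))//.
    rewrite -mulrA ler_wpM2l//.
    apply: le_trans (_ : 1 * `|y - b| <= _).
      by rewrite ler_wpM2r// (ratio_le1 phi_sim r_lt1).
    by rewrite mul1r (le_trans (ler_normB _ _))// lerD2r UM.
  by apply: F_bounded; exact: word_map_stable.
have [K OK] := O_bounded.
have clOK x : closure O x -> `|x| <= K + 1.
  move=> /rV_closureP/(_ 1 ltr01)[y /OK yK xy].
  by rewrite -(subrK y x) addrC (le_trans (ler_normD _ _))// lerD// ltW.
(* [O] is [X] together with [Phi phi O], according to whether the word is empty; the right-hand side
   is closed as a finite union. *)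
have clO_dec : closure O `<=` closure X `|` Phi phi (closure O).
  have cl : closed (closure X `|` Phi phi (closure O)).
    apply: closedU; first exact: closed_closure.
    apply: closed_bigcup; first exact: finite_finset.
    by move=> i _; apply: (similarity_closed (phi_sim i)); exact: closed_closure.
  rewrite [X in _ `<=` X](proj1 (closure_id _) cl); apply: closure_subset.
  move=> _ [[|i w] _ [x Xx <-]] /=; first by left; exact: subset_closure.
  right; exists i => //; exists (word_map phi w x) => //; apply: subset_closure.
  by exists w => //; exists x.
have F_of A : (forall x, A x -> `|x| <= K + 1) -> A `<=` F `|` Phi phi A -> A `<=` F.
  move=> AK /(sub_closure_iter phi_sim r_lt1 AK F0 PF).
  by rewrite -(proj1 (closure_id _) F_closed).
have clX : closure X `<=` X `|` F.
  move=> x /(similarity_closure (word_map_similarity phi_sim k))[y /clU[Uy|Fy] <-].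
    by left; exists y.
  by right; exact: word_map_stable.
(* A boundary point of [O] outside [F] cannot come from the closure of [X], so it is the image of a
   point of the closure of [O]. That point is not in [O] either, since [O] is stable, and [F_of]
   applies. *)
have clOF : closure O `\` O `<=` F.
  apply: F_of => [x [/clOK]//|x [clOx nOx]].
  have [/clX[[y Uy yx]|]|] := clO_dec _ clOx; last first.
  - move=> [i _ [y clOy yx]]; right; exists i => //; exists y => //; split => // Oy.
    by apply: nOx; rewrite -yx; apply: PO; exists i => //; exists y.
  - by left.
  - by exfalso; apply: nOx; rewrite -yx; exact: (OE [::]).
exists O, (tiling_family phi O); split; last first.
  by move=> x [clOx]; rewrite (proj1 (interior_id _) O_open) => nOx; exact: clOF.
split => //; apply: contrapT => /set0P/negP/negPn/eqP G0.
(* With an empty generator, each point of [O] has a preimage in the closure of [O]: either in [O]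
   again, or on its boundary and hence in [F]. *)
have OF : O `<=` F.
  apply: F_of => [x Ox|x Ox]; first exact/clOK/subset_closure.
  have [i _ [y clOy yx]] : Phi phi (closure O) x.
    by apply: contrapT => nP; have : set0 x by rewrite -G0.
  have [yO|yNO] := pselect (O y); first by right; exists i => //; exists y.
  by left; rewrite -yx; apply: PF; exists i => //; exists y => //; exact: clOF.
have : set0 (word_map phi ([::] ++ k) u0); last by [].
rewrite -intF; apply: filterS OF _; apply: open_nbhs_nbhs; split => //.
exact: OE.
Qed.

End Tilings.

Theorem theorem7p2 (R : realType) (d N : nat)
    (phi : 'I_N -> 'rV[R]_d -> 'rV[R]_d) (F : set 'rV[R]_d)
    (N_ge2 : (2 <= N)%N)
    (phi_sim : forall i, contracting_similarity (phi i))
    (F_attractor : self_similar_set phi F)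
    (F_OSC : open_set_condition phi)
    (F_dim : minkowski_dim F < d%:R) :
  possesses_compatible_tiling phi F <-> ~ connected (~` F).
Proof.
have [F0 cF FE] := F_attractor.
have /choice[r rP] i : exists s : R,
    0 < s < 1 /\ forall x y, edist (phi i x) (phi i y) = s * edist x y.
  by have [s s01 sE] := phi_sim i; exists s.
have sim i : similarity (r i) (phi i).
  by have [/andP[? _] ?] := rP i.
have r_lt1 i : r i < 1 by have [/andP[]] := rP i.
have F_closed : closed F by apply: compact_closed cF; exact: norm_hausdorff.
have [M FM] : exists M, forall x, F x -> `|x| <= M.
  have [M [_ MF]] := compact_bounded cF.
  by exists (M + 1) => x Fx; apply: (MF (M + 1)) => //; rewrite ltrDl.
have intF : interior F = set0.
  apply/eqP/negPn/negP => /set0P /(minkowski_dim_interior FM) E.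
  by move: F_dim; rewrite E ltxx.
split; first exact: (compatible_disconnected N_ge2 sim r_lt1 FE FM).
move=> disc.
have : exists W, [/\ W !=set0, open W, forall x, W x -> `|x| <= M & closure W `<=` W `|` F].
  have [d2|] := leqP 2 d; first exact: bounded_hole_dim_ge2.
  rewrite ltnS leq_eqVlt ltnS leqn0 => /orP[/eqP d1|/eqP d0].
    have [x [y [Fx Fy xy]]] := attractor_not_singleton_dim1 N_ge2 sim F0 FE d1 F_OSC.
    clear - F_closed FM intF Fx Fy xy d1; subst d.
    exact: bounded_hole_dim1 F_closed FM intF Fx Fy xy.
  (* For [d = 0] the space is one point, so [F^c] is empty and therefore connected. *)
  exfalso; apply: disc; suff -> : ~` F = set0 by exact: connected0.
  have [x Fx] := F0; apply/seteqP; split => // y; apply.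
  suff -> : y = x by [].
  by apply/rowP => -[j jd]; exfalso; move: jd; rewrite d0.
move=> [W [W0 oW WM clW]].
exact: (compatible_of_hole sim r_lt1 F0 F_closed FE FM F_OSC intF W0 oW WM clW).
Qed.
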